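(* Let $0<d<1$, let $S\subseteq\mathbb{R}$ be a measurable set of positive finite Lebesgue measure, and let $\Lambda\subseteq\mathbb{R}$ be uniformly discrete. If $E(\Lambda)$ is $d$-approximately uniformly minimal in $L^2(S)$, then $$D^+(\Lambda)\leq \frac{|S|}{1-d^2}.$$
   Context: $|S|$ denotes the Lebesgue measure of $S$. A set $\Lambda\subseteq\mathbb{R}$ is uniformly discrete if there is a constant $\delta>0$ with $|\lambda-\gamma|\ge\delta$ for all distinct $\lambda,\gamma\in\Lambda$. For $\lambda\in\mathbb{R}$ put $e_\lambda(t)=e^{2\pi i\lambda t}$, and let $E(\Lambda)=\{e_\lambda\}_{\lambda\in\Lambda}$, regarded as a system in $L^2(S)$, with inner product $\langle f,g\rangle_{L^2(S)}=\int_S f\overline{g}$. Upper density: $D^+(\Lambda)=\lim_{r\to\infty}\frac{1}{r}\max_{x\in\mathbb{R}}\#(\Lambda\cap[x,x+r])$. Definition. For $0<d<1$, $E(\Lambda)$ is $d$-approximately uniformly minimal in $L^2(S)$ if there exist functions $\{g_\lambda\}_{\lambda\in\Lambda}\subseteq L^2(S)$ with $\sup_{\lambda\in\Lambda}\|g_\lambda\|_{L^2(S)}<\infty$ such that for every $\lambda\in\Lambda$, $$\|\widehat{g}_\lambda-\delta_\lambda\|_{\ell^2(\Lambda)}\le d,$$ where $\widehat{g}_\lambda(\gamma)=\langle g_\lambda,e_\gamma\rangle_{L^2(S)}$ for $\gamma\in\Lambda$, and $\delta_\lambda$ is the function on $\Lambda$ equal to $1$ at $\lambda$ and $0$ elsewhere.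 *)

(* Defs.v *)
From HB Require Import structures.
From mathcomp Require Import all_boot all_order all_algebra.
From mathcomp Require Import all_classical all_reals all_analysis.
From mathcomp.real_closed Require Export complex.

Set Implicit Arguments.
Unset Strict Implicit.
Unset Printing Implicit Defensive.
Import Order.TTheory GRing.Theory Num.Theory.
Import numFieldNormedType.Exports.

Local Open Scope classical_set_scope.
Local Open Scope ring_scope.
Local Open Scope complex_scope.

(* R equipped with the sigma-algebra of all Lebesgue measurable sets, i.e. the
   domain of the completed Lebesgue measure; the canonical [measurable] sets of
   [R] are only the Borel sets. *)
Definition lebesgueTypeR (R : realType) :=
  caratheodory_type ((wlength (@idfun R))^*)%mu.

Definition lebesgue_measurable (R : realType) (S : set R) : Prop :=
  @measurable _ (lebesgueTypeR R) S.

Section ComplexL2.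
Context {d : measure_display} {T : measurableType d} {R : realType}.
Variables (mu : {measure set T -> \bar R}) (D : set T).
Implicit Types f g : T -> R[i].

Definition cmeasurable_fun f : Prop :=
  measurable_fun D (fun t => complex.Re (f t)) /\ measurable_fun D (fun t => complex.Im (f t)).

Definition cintegral f : R[i] :=
  (\int[mu]_(t in D) complex.Re (f t)) +i* (\int[mu]_(t in D) complex.Im (f t)).

Definition L2norm f : \bar R :=
  sqrte (\int[mu]_(t in D) ((Normc.normc (f t)) ^+ 2)%:E)%E.

Definition inL2 f : Prop := cmeasurable_fun f /\ (L2norm f < +oo)%E.

Definition L2inner f g : R[i] := cintegral (fun t => f t * conjc (g t)).

End ComplexL2.

Section Exponentials.
Variable R : realType.
Implicit Types (L S : set R).

Definition uniformly_discrete L : Prop :=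
  exists2 delta : R, 0 < delta &
    forall x y, L x -> L y -> x <> y -> delta <= `|x - y|.

Definition expi (lambda t : R) : R[i] :=
  cos (2 * pi * lambda * t) +i* sin (2 * pi * lambda * t).

Definition ell2norm L (a : R -> R[i]) : \bar R :=
  sqrte (\esum_(x in L) ((Normc.normc (a x)) ^+ 2)%:E)%E.

Local Notation mu := (@completed_lebesgue_measure R).

(* Only the values [g lambda] for [lambda] in [L] matter. *)
Definition approx_unif_minimal (d : R) S L : Prop :=
  exists g : R -> lebesgueTypeR R -> R[i],
  [/\ forall lambda, L lambda -> inL2 mu S (g lambda),
      (ereal_sup [set L2norm mu S (g lambda) | lambda in L] < +oo)%E &
      forall lambda, L lambda ->
        (ell2norm L (fun gamma =>
           L2inner mu S (g lambda) (expi gamma) - (gamma == lambda)%:R)%R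
         <= d%:E)%E].

(* For uniformly discrete [L] the counts are bounded integers, so the supremum
   is a maximum; it is subadditive in [r], so the limit exists. *)
Definition upper_density L : \bar R :=
  lim ((r^-1%:E * ereal_sup [set counting (L `&` `[x, (x + r)%R]) | x in [set: R]])%E
       @[r --> +oo%R]).

End Exponentials.

(* Main.v *)
Require Import Defs.
From HB Require Import structures.
From mathcomp Require Import all_boot all_order all_algebra.
From mathcomp Require Import all_classical all_reals all_analysis.
From mathcomp Require Import measurable_realfun spectral ring lra.

(** Why the theorem holds.

Let [F] be [n] points of [Lambda] in a window [[x, x + r]], and let
[A] be the [n * n] matrix of the inner products [<g_l, e_h>] in [L^2(S)], for
[l, h] in [F]. By assumption every row of [A] is within [d] of the
corresponding row of the identity in [l^2], so the squared Hilbert-Schmidt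
distance from [A] to the identity is at most [n * d^2]. A matrix of rank [k] is
at squared distance at least [n - k] from the identity; hence, if [A] had rank
at most [k], then [n * (1 - d^2) <= k]. It remains to see that [A] is, in a
suitable sense, almost of rank [|S| r + O(1)]: dividing by [r] and letting [r]
tend to infinity then gives the bound on the density.

The almost-rank statement is a count of degrees of freedom: all exponentials
with frequency in a window of length [r] lie, up to a small error in [L^2(S)],
in a space of dimension [(|S| + eta) r + C] with [C] independent of the window
([exp_approx_finite_measure]). For an interval of length [l], rescaled to the
unit interval, the space is spanned by the exponentials of frequency in
[n0 + Z] lying in the window, which has length [l r] after rescaling, slightly
enlarged; the enlargement [T] does not depend on [r], because the Fourier
coefficients decay like the inverse of the distance between frequencies
([trig_approx]). This is proved with the discrete Fourier transform on a fine
grid, where Parseval's identity is finite algebra. A set of finite measure is a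
finite disjoint union of subsets of intervals, of total length at most
[|S| + eta], and of a remainder of small measure, on which every exponential
is small in norm.

Finally, replacing the exponentials by their approximants perturbs [A] by a
matrix [E] of inner products of the [g_l] with small functions. The [g_l] are
bounded in norm but need not form a Bessel system, so [E] need not be small in
Hilbert-Schmidt norm. What is small is the pairing of [E] with an orthogonal
projection [Q]: pointwise in [t] the form [sum_(l,h) g_l(t) conj(w_h(t)) Q_hl]
is at most the product of the Euclidean norms of [g(t)] and [w(t)], because [Q]
is a contraction, and integrating gives [n] times a small constant
([projection_pairing_integral]). Taking for [Q] the projection onto the kernel
of the low-rank part of [A] and comparing traces ([corank_le]) gives the
counting inequality [counting_bound]. *)

Set Implicit Arguments.
Unset Strict Implicit.
Unset Printing Implicit Defensive.
Import Order.TTheory GRing.Theory Num.Theory.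
Import numFieldNormedType.Exports.

Local Open Scope classical_set_scope.
Local Open Scope ring_scope.

(** * Squared modulus of complex numbers *)

Section SquaredModulus.
Variable R : rcfType.
Implicit Types z w : R[i].

(** Polynomial in the real and imaginary parts, unlike the norm: easier to
integrate and to feed to [nra]. *)
Definition csq z : R := complex.Re z ^+ 2 + complex.Im z ^+ 2.

Lemma csqE z : (Normc.normc z) ^+ 2 = csq z.
Proof. by case: z => a b; rewrite /csq /= sqr_sqrtr// addr_ge0 ?sqr_ge0. Qed.

Lemma csq_ge0 z : 0 <= csq z.
Proof. by rewrite addr_ge0 ?sqr_ge0. Qed.

Lemma csq0 : csq 0 = 0.
Proof. by rewrite /csq/= expr0n/= addr0. Qed.

Lemma csq_eq0 z : (csq z == 0) = (z == 0).
Proof.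
case: z => a b.
by rewrite /csq eq_complex paddr_eq0 ?sqr_ge0// !expf_eq0.
Qed.

Lemma csqM z w : csq (z * w) = csq z * csq w.
Proof. by rewrite -!csqE Normc.normcM exprMn. Qed.

Lemma csqN z : csq (- z) = csq z.
Proof. by case: z => a b; rewrite /csq/= !sqrrN. Qed.

Lemma csqJ z : csq (conjc z) = csq z.
Proof. by case: z => a b; rewrite /csq/= sqrrN. Qed.

Lemma csq_real (a : R) : csq a%:C%C = a ^+ 2.
Proof. by rewrite /csq /= expr0n addr0. Qed.

Lemma mulcJ z : z * conjc z = (csq z)%:C%C.
Proof. by case: z => a b; rewrite /csq; simpc; congr (_ +i* _)%C; ring. Qed.

Lemma csqD_le z w : csq (z + w) <= 2 * csq z + 2 * csq w.
Proof.
case: z w => a b [c e]; rewrite /csq /=.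
have := sqr_ge0 (a - c); have := sqr_ge0 (b - e); nra.
Qed.

Lemma Re_addc z w : complex.Re (z + w) = complex.Re z + complex.Re w.
Proof. by case: z w => a b [c e]. Qed.

Lemma Im_addc z w : complex.Im (z + w) = complex.Im z + complex.Im w.
Proof. by case: z w => a b [c e]. Qed.

Lemma Re_mulc z w : complex.Re (z * w) =
  complex.Re z * complex.Re w - complex.Im z * complex.Im w.
Proof. by case: z w => a b [c e]. Qed.

Lemma Im_mulc z w : complex.Im (z * w) =
  complex.Re z * complex.Im w + complex.Im z * complex.Re w.
Proof. by case: z w => a b [c e]; rewrite /=; ring. Qed.

Lemma Re_sum (I : Type) (r : seq I) (P : pred I) (F : I -> R[i]) :
  complex.Re (\sum_(i <- r | P i) F i) = \sum_(i <- r | P i) complex.Re (F i).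
Proof. by apply: (big_morph _ Re_addc). Qed.

Lemma Im_sum (I : Type) (r : seq I) (P : pred I) (F : I -> R[i]) :
  complex.Im (\sum_(i <- r | P i) F i) = \sum_(i <- r | P i) complex.Im (F i).
Proof. by apply: (big_morph _ Im_addc). Qed.

(** Weighted AM-GM. All the Cauchy-Schwarz inequalities below are used in this
linearised form, which passes to sums and integrals without square roots. *)
Lemma Re_mul_le z w (s : R) : 0 < s ->
  2 * complex.Re (z * w) <= s * csq z + s^-1 * csq w.
Proof.
move=> s0; case: z w => a b [c e]; rewrite /csq /=.
have -> : s * (a ^+ 2 + b ^+ 2) + s^-1 * (c ^+ 2 + e ^+ 2) =
  s^-1 * ((s * a - c) ^+ 2 + (s * b + e) ^+ 2) + 2 * (a * c - b * e).
  by field; rewrite gt_eqF.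
by rewrite lerDr mulr_ge0 ?invr_ge0 ?(ltW s0)// addr_ge0 ?sqr_ge0.
Qed.

End SquaredModulus.

(** * Corank and the projection onto a kernel *)

Section Projection.
Local Open Scope sesquilinear_scope.

(** [Q] is the orthogonal projection onto the kernel of [A]: orthonormalise a
basis of the kernel into the rows of [U] (up to transposition) and take
[Q = U^T * conj U]. *)
Lemma kernel_projection (C : numClosedFieldType) n (A : 'M[C]_n) :
  exists Q : 'M[C]_n,
    [/\ Q^t* = Q, Q *m Q = Q, A *m Q = 0 & \tr Q = (n - \rank A)%:R].
Proof.
pose K := row_base (kermx A^T).
pose U : 'M[C]_(\rank (kermx A^T), n) := schmidt K.
have rn : (\rank (kermx A^T) <= n)%N by exact: rank_leq_row.
have Uu : U *m U^t* = 1%:M by apply/unitarymxP; exact: schmidt_unitarymx.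
have UA : U *m A^T = 0.
  apply/sub_kermxP; rewrite eqmx_schmidt_free ?row_base_free//.
  by rewrite eq_row_base.
have Uc : map_mx Num.conj U *m U^T = 1%:M.
  have := congr1 (fun M => M^T) Uu.
  by rewrite trmx_mul trmx1 map_trmx trmxK.
exists (U^T *m map_mx Num.conj U); split.
- rewrite trmx_mul map_mxM trmxK; congr (_ *m _).
  by apply/matrixP => i j; rewrite !mxE; exact: conjCK.
- by rewrite mulmxA -(mulmxA U^T) Uc mulmx1.
- have AU : A *m U^T = 0 by apply: trmx_inj; rewrite trmx_mul trmxK UA trmx0.
  by rewrite mulmxA AU mul0mx.
- by rewrite mxtrace_mulC Uc mxtrace1 mxrank_ker mxrank_tr.
Qed.
End Projection.

Section LinearAlgebra.
Variable R : rcfType.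
Local Open Scope sesquilinear_scope.

(** Pythagoras: [|v|^2 = |Q v|^2 + |v - Q v|^2]. *)
Lemma projection_contraction n (Q : 'M[R[i]]_n) (a : 'I_n -> R[i]) :
  Q^t* = Q -> Q *m Q = Q ->
  \sum_i csq (\sum_j Q i j * a j) <= \sum_j csq (a j).
Proof.
move=> Qh QQ.
pose v : 'cV[R[i]]_n := \col_j a j.
have Sq (w : 'cV[R[i]]_n) : (w^t* *m w) 0 0 = (\sum_i csq (w i 0))%:C%C.
  rewrite mxE (rmorph_sum (real_complex R)); apply: eq_bigr => i _.
  by rewrite !mxE mulrC; exact: mulcJ.
have P1 : (Q *m v)^t* *m (Q *m v) = v^t* *m (Q *m v).
  by rewrite trmx_mul map_mxM/= Qh -mulmxA (mulmxA Q) QQ.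
have P2 : (v - Q *m v)^t* *m (v - Q *m v) = v^t* *m v - (Q *m v)^t* *m (Q *m v).
  have -> : (v - Q *m v)^t* = v^t* - (Q *m v)^t*.
    by apply/matrixP => i j; rewrite !mxE -/(Q *m v) rmorphB.
  have P3 : (Q *m v)^t* *m v = v^t* *m (Q *m v).
    by rewrite trmx_mul map_mxM/= Qh mulmxA.
  by rewrite mulmxBl !mulmxBr P1 P3 subrr subr0.
have : \sum_i csq ((v - Q *m v) i 0) =
       \sum_i csq (v i 0) - \sum_i csq ((Q *m v) i 0).
  apply: (@complexI R); rewrite rmorphB/= -!Sq P2.
  by rewrite [in LHS]mxE [X in _ + X]mxE.
have -> : \sum_i csq (v i 0) = \sum_j csq (a j).
  by apply: eq_bigr => j _; rewrite mxE.
move=> E.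
have : 0 <= \sum_i csq ((v - Q *m v) i 0) by apply: sumr_ge0 => i _; exact: csq_ge0.
rewrite E subr_ge0; apply: le_trans.
rewrite le_eqVlt; apply/orP; left; apply/eqP; apply: eq_bigr => i _; congr csq.
by rewrite mxE; apply: eq_bigr => j _; rewrite mxE.
Qed.

Lemma projection_pairing n (Q : 'M[R[i]]_n) (a b : 'I_n -> R[i]) (s : R) :
  Q^t* = Q -> Q *m Q = Q -> 0 < s ->
  2 * complex.Re (\sum_i \sum_j a i * conjc (b j) * Q j i) <=
    s * (\sum_i csq (a i)) + s^-1 * (\sum_j csq (b j)).
Proof.
move=> Qh QQ s0; rewrite exchange_big /=.
rewrite (eq_bigr (fun j => (\sum_i Q j i * a i) * conjc (b j))); last first.
  move=> j _; rewrite mulr_suml; apply: eq_bigr => i _.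
  by rewrite mulrC mulrA.
rewrite Re_sum mulr_sumr.
apply: (@le_trans _ _ (\sum_j (s * csq (\sum_i Q j i * a i) + s^-1 * csq (b j)))).
  apply: ler_sum => j _; rewrite -(csqJ (b j)); exact: Re_mul_le.
rewrite big_split /= -!mulr_sumr lerD2r ler_pM2l//.
exact: projection_contraction.
Qed.

(** Let [Q] be the projection onto [ker A]; its trace [m] is the corank of [A].
Since [A Q = 0], [m = tr (D Q) + tr (E Q)]. The squared Hilbert-Schmidt norm of
[Q] is again [m], so AM-GM gives [2 Re tr (D Q) <= |D|^2 + m], and one copy of
[m] cancels. *)
Lemma corank_le n (D E A : 'M[R[i]]_n) (K : R) :
  1%:M = D + E + A ->
  (forall Q : 'M[R[i]]_n, Q^t* = Q -> Q *m Q = Q ->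
    2 * complex.Re (\sum_i \sum_j E i j * Q j i) <= K) ->
  (n - \rank A)%:R <= \sum_i \sum_j csq (D i j) + K.
Proof.
move=> ID hK; have [Q [Qh QQ AQ trQ]] := kernel_projection A.
have trE (M : 'M[R[i]]_n) : \tr (M *m Q) = \sum_i \sum_j M i j * Q j i.
  by rewrite /mxtrace; apply: eq_bigr => i _; rewrite mxE.
have tr_nat : complex.Re (\tr Q) = (n - \rank A)%:R.
  by rewrite trQ -(rmorph_nat (real_complex R)).
have QQsum : \sum_i \sum_j csq (Q j i) = (n - \rank A)%:R.
  rewrite -tr_nat -[in RHS]QQ trE Re_sum; apply: eq_bigr => i _.
  rewrite Re_sum; apply: eq_bigr => j _.
  have -> : Q i j = conjc (Q j i) by rewrite -[in LHS]Qh !mxE.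
  by rewrite mulrC mulcJ.
have := congr1 (fun M => complex.Re (\tr (M *m Q))) ID.
rewrite /= mul1mx !mulmxDl AQ addr0 mxtraceD Re_addc tr_nat => m_eq.
have HE : 2 * complex.Re (\tr (E *m Q)) <= K by rewrite trE hK.
have HD : 2 * complex.Re (\tr (D *m Q)) <=
    \sum_i \sum_j csq (D i j) + (n - \rank A)%:R.
  rewrite -QQsum trE Re_sum mulr_sumr -big_split /=; apply: ler_sum => i _.
  rewrite Re_sum mulr_sumr -big_split /=; apply: ler_sum => j _.
  by have := Re_mul_le (D i j) (Q j i) ltr01; rewrite invr1 !mul1r.
lra.
Qed.

End LinearAlgebra.

(** * The function [x |-> exp (2 i pi x)] *)

Section Cis.
Variable R : realType.
Implicit Types (x y z : R).

Definition cis x : R[i] := expi x 1.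

Arguments cis : simpl never.

Lemma expiE x y : expi x y = cis (x * y).
Proof. by rewrite /cis /expi !mulr1 !mulrA. Qed.

Lemma cisD x y : cis (x + y) = cis x * cis y.
Proof.
rewrite /cis /expi !mulr1 mulrDr cosD sinD; apply/eqP.
by rewrite eq_complex /= eqxx addrC eqxx.
Qed.

Lemma cis0 : cis 0 = 1.
Proof. by rewrite /cis /expi mulr1 mulr0 cos0 sin0. Qed.

Lemma cisN x : cis (- x) = conjc (cis x).
Proof. by rewrite /cis /expi !mulr1 mulrN cosN sinN. Qed.

Lemma cisMn x n : cis (x * n%:R) = cis x ^+ n.
Proof.
elim: n => [|n IH]; first by rewrite mulr0 cis0.
by rewrite -addn1 natrD mulrDr mulr1 cisD IH exprD expr1.
Qed.

Lemma cis_nat n : cis n%:R = 1.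
Proof.
rewrite -[n%:R]mul1r cisMn (_ : cis 1 = 1) ?expr1n//.
by rewrite /cis /expi !mulr1 mulrC mulr_natr cos2pi (_ : sin _ = 0) ?sin2pi.
Qed.

Lemma csq_cis x : csq (cis x) = 1.
Proof. exact: cos2Dsin2. Qed.

Lemma csq_cisB x y : csq (cis x - cis y) = 4 * sin (pi * (x - y)) ^+ 2.
Proof.
have -> : cis x = cis (x - y) * cis y by rewrite -cisD subrK.
rewrite -[X in _ - X]mul1r -mulrBl csqM csq_cis mulr1 /cis /expi /csq /= !mulr1.
have -> : 2 * pi * (x - y) = (pi * (x - y)) *+ 2 by rewrite -mulr_natr; ring.
set t := pi * _.
rewrite cos_mulr2n sin_mulr2n; have := cos2Dsin2 t; set c := cos t; set s := sin t.
move=> E; have {}E : c ^+ 2 = 1 - s ^+ 2 by rewrite -E addrK.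
transitivity ((2 * c ^+ 2 - 2) ^+ 2 + 4 * c ^+ 2 * s ^+ 2); first by ring.
by rewrite E; ring.
Qed.

Lemma sin_MVT x : 0 <= x -> exists2 c, c \in `[0, x] & sin x = cos c * x.
Proof.
move=> x0.
have [|c cx] := @MVT_segment R sin cos 0 x x0 (fun t _ => is_derive_sin t).
  by apply: continuous_subspaceT => t; exact: continuous_sin.
by rewrite sin0 !subr0 => E; exists c.
Qed.

Lemma sin_sqr_le x : sin x ^+ 2 <= x ^+ 2.
Proof.
wlog x0 : x / 0 <= x.
  move=> H; have [/H//|/ltW x0] := leP 0 x.
  by rewrite -sqrrN -sinN -[leRHS]sqrrN H ?oppr_ge0.
have [c _ ->] := sin_MVT x0.
rewrite exprMn ler_piMl ?sqr_ge0//.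
Qed.

(** Halving the angle and applying the mean value theorem at [x / 2] gives
[sin x >= x * cos (x / 2) ^+ 2], and [cos (pi / 4) ^+ 2 = 1 / 2]. *)
Lemma sin_ge_half x : 0 <= x <= pi / 2 -> x / 2 <= sin x.
Proof.
move=> /andP[x0 xpi].
have pi2 := pi_ge2 R.
have h0 : 0 <= x / 2 by rewrite divr_ge0.
have [c /[!in_itv]/= /andP[c0 cx] Es] := sin_MVT h0.
have cc : cos (x / 2) <= cos c.
  by rewrite leNgt ltr_cos -?leNgt ?in_itv/=//; apply/andP; split; lra.
have q : 2^-1 <= cos (x / 2) ^+ 2.
  have := cos_mulr2n (x / 2).
  have : 0 <= cos (x / 2 *+ 2).
    by apply: cos_ge0_pihalf; rewrite -mulr_natr; apply/andP; split; lra.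
  by rewrite -mulr_natl; lra.
have p : 0 <= cos (x / 2) by apply: cos_ge0_pihalf; apply/andP; split; lra.
have -> : sin x = cos (x / 2) * sin (x / 2) *+ 2.
  by rewrite -sin_mulr2n; congr sin; rewrite -mulr_natr; field.
rewrite Es -[leRHS]mulr_natr; set u := cos (x / 2) in cc p q *.
have -> : u * (cos c * (x / 2)) * 2 = u * cos c * x by field.
have -> : x / 2 = 2^-1 * x by rewrite mulrC.
apply: ler_wpM2r => //; apply: le_trans q _.
by rewrite expr2; apply: ler_wpM2l.
Qed.

(** [|1 - cis t|] is at least twice the distance from [t] to the nearest of [0]
and [1]; adding both inverse squares avoids a case distinction later, when the
bound is summed over a range of [t]. *)
Lemma csq_1Bcis_inv t : 0 < t < 1 ->
  (csq (1 - cis t))^-1 <= 4^-1 * ((t ^+ 2)^-1 + ((1 - t) ^+ 2)^-1).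
Proof.
move=> /andP[t0 t1].
have pi2 := pi_ge2 R.
have key (s : R) : 0 < s <= 2^-1 -> (sin (pi * s) ^+ 2)^-1 <= (s ^+ 2)^-1.
  move=> /andP[s0 s1]; rewrite lef_pV2 ?posrE ?exprn_gt0//.
    have H : pi * s / 2 <= sin (pi * s).
      by apply: sin_ge_half; apply/andP; split; nra.
    have {}H : s <= sin (pi * s) by nra.
    by rewrite ler_sqr ?nnegrE//; lra.
  by apply: sin_gt0_pi; apply/andP; split; nra.
have E : csq (1 - cis t) = 4 * sin (pi * t) ^+ 2.
  by rewrite -cis0 csq_cisB sub0r mulrN sinN sqrrN.
rewrite E invfM ler_pM2l ?invr_gt0//.
have [th|th] := leP t 2^-1.
  by rewrite (le_trans (key t _))// ?t0// lerDl invr_ge0 sqr_ge0.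
have -> : sin (pi * t) = sin (pi * (1 - t)).
  by rewrite mulrBr mulr1 sinB sinpi cospi mul0r sub0r mulN1r opprK.
rewrite (le_trans (key (1 - t) _))//; first by apply/andP; split; lra.
by rewrite lerDr invr_ge0 sqr_ge0.
Qed.

Lemma normc_cisB x y : Normc.normc (cis x - cis y) <= 2 * pi * `|x - y|.
Proof.
have H : 0 <= 2 * pi * `|x - y| by rewrite !mulr_ge0 ?pi_ge0.
rewrite -ler_sqr ?nnegrE// ?csqE; last first.
  by case: (cis x - cis y) => a b /=; exact: sqrtr_ge0.
rewrite csq_cisB; have := sin_sqr_le (pi * (x - y)).
rewrite !exprMn real_normK ?num_real//; lra.
Qed.

End Cis.
Arguments cis : simpl never.
Arguments conjc : simpl never.

(** * The discrete Fourier transform on [Z / M] *)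

Section DFT.
Variables (R : realType) (M : nat).
Hypothesis M_gt0 : (0 < M)%N.

Let M_gt0R : 0 < M%:R :> R. Proof. by rewrite ltr0n. Qed.
Let M_neq0 : M%:R != 0 :> R. Proof. by rewrite gt_eqF. Qed.
Let M_neq0C : M%:R != 0 :> R[i]. Proof. by rewrite pnatr_eq0 -lt0n. Qed.

(** The character of index [n] of the group [Z / M], at [c]. *)
Definition chi (n c : nat) : R[i] := cis (n%:R * c%:R / M%:R).

Arguments chi : simpl never.

Lemma chiC n c : chi n c = chi c n.
Proof. by rewrite /chi (mulrC n%:R). Qed.

Lemma geometric_cis (t : R) :
  (\sum_(c < M) cis (t * c%:R)) * (1 - cis t) = 1 - cis (t * M%:R).
Proof.
rewrite -[LHS]opprK -mulrN opprB mulrC -[RHS]opprB; congr (- _).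
rewrite cisMn subrX1; congr (_ * _).
by apply: eq_bigr => c _; rewrite cisMn.
Qed.

Lemma cis_neq1 (t : R) : 0 < `|t| < 1 -> cis t != 1.
Proof.
wlog t0 : t / 0 < t.
  move=> H; have [t0|t0|->] := ltgtP t 0; last by rewrite normr0 ltxx.
    rewrite -normrN => /H; rewrite oppr_gt0 cisN => /(_ t0); apply: contra.
    by move=> /eqP ->; rewrite conjc1.
  exact: H.
rewrite gtr0_norm// => /andP[_ t1]; apply/eqP => t_eq.
have : csq (cis t - cis 0) = 0 by rewrite t_eq cis0 subrr csq0.
rewrite csq_cisB subr0 => /eqP; rewrite mulf_eq0 pnatr_eq0/= expf_eq0/= => /eqP.
have := @sin_gt0_pi R (pi * t); have := pi_ge2 R => pi2 H Z.
by move: H; rewrite Z ltxx => /implyP; rewrite implybF => /negP; apply; nra.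
Qed.

(** A geometric sum of ratio an [M]-th root of unity, which is [1] only if
[n = m]. *)
Lemma chi_orthogonal (n m : 'I_M) :
  \sum_(c < M) chi n c * conjc (chi m c) = if n == m then M%:R else 0.
Proof.
pose t : R := (n%:R - m%:R) / M%:R.
have E c : chi n c * conjc (chi m c) = cis (t * c%:R).
  by rewrite /chi -cisN -cisD; congr cis; rewrite /t; field.
under eq_bigr => c _ do rewrite E.
have [nm|nm] := eqVneq n m.
  rewrite (eq_bigr (fun=> 1)) ?sumr_const ?card_ord// => c _.
  by rewrite /t nm subrr !mul0r cis0.
have t1 : cis t != 1.
  apply: cis_neq1; rewrite /t normrM normfV (@ger0_norm _ M%:R)//.
  rewrite divr_gt0//=; last first.
    by rewrite normr_gt0 subr_eq0 eqr_nat.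
  rewrite ltr_pdivrMr// mul1r.
  have := ltn_ord n; have := ltn_ord m; rewrite -!(ltr_nat R) => mM nM.
  have := ler0n R n; have := ler0n R m.
  by move=> m0 n0; rewrite ltr_norml; apply/andP; split; lra.
have := geometric_cis t.
have -> : cis (t * M%:R) = 1.
  by rewrite /t divfK// cisD cisN !cis_nat conjc1 mulr1.
rewrite subrr => /eqP; rewrite mulf_eq0 subr_eq0 => /orP[/eqP//|].
by rewrite eq_sym (negbTE t1).
Qed.

Definition dft (v : 'I_M -> R[i]) (n : nat) : R[i] :=
  M%:R^-1 * \sum_(c < M) v c * conjc (chi n c).

Lemma dft_inversion v (c : 'I_M) : \sum_(n < M) dft v n * chi n c = v c.
Proof.
under eq_bigr do rewrite /dft -mulrA mulr_suml mulr_sumr.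
rewrite exchange_big /= (bigD1 c)//= [X in _ + X]big1 ?addr0.
- under eq_bigr => n _ do
    rewrite -(mulrA (v _)) (mulrC (conjc _)) !(chiC n).
  by rewrite -mulr_sumr -mulr_sumr chi_orthogonal eqxx mulrC mulfK.
- move=> c' c'c; under eq_bigr => n _ do
    rewrite -(mulrA (v _)) (mulrC (conjc _)) !(chiC n).
  by rewrite -mulr_sumr -mulr_sumr chi_orthogonal eq_sym (negbTE c'c) !mulr0.
Qed.

Lemma dft_parseval (b : 'I_M -> R[i]) :
  \sum_(c < M) csq (\sum_n b n * chi n c) = M%:R * \sum_n csq (b n).
Proof.
apply: (@complexI R); rewrite rmorphM rmorph_nat !rmorph_sum /=.
under eq_bigr => c _ do rewrite -mulcJ rmorph_sum mulr_suml.
rewrite exchange_big/= mulr_sumr; apply: eq_bigr => n _.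
under eq_bigr => c _ do rewrite mulr_sumr.
rewrite exchange_big/= (bigD1 n)//= [X in _ + X]big1 ?addr0.
- under eq_bigr => c _ do rewrite rmorphM mulrACA.
  by rewrite -mulr_sumr chi_orthogonal eqxx mulcJ mulrC.
- move=> m mn; under eq_bigr => c _ do rewrite rmorphM mulrACA.
  by rewrite -mulr_sumr chi_orthogonal eq_sym (negbTE mn) mulr0.
Qed.

End DFT.

(** * Approximating a non-integer frequency by integer frequencies *)

Section Tail.
Variable R : realType.

Lemma inv_sqr_telescope (x : R) : 1 < x -> (x ^+ 2)^-1 <= (x - 1)^-1 - x^-1.
Proof.
move=> x1.
have -> : (x - 1)^-1 - x^-1 = ((x - 1) * x)^-1.
  by field; apply/andP; split; lra.
by rewrite lef_pV2 ?posrE; nra.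
Qed.

Definition dft_cis (M : nat) (y : R) (n : nat) : R[i] :=
  dft (fun c : 'I_M => cis (y * (c%:R / M%:R))) n.

Lemma csq_dft_le1 (M : nat) (y : R) (n : 'I_M) : csq (dft_cis M y n) <= 1.
Proof.
have M_gt0 : (0 < M)%N by apply: leq_ltn_trans (ltn_ord n).
have M_gt0R : 0 < M%:R :> R by rewrite ltr0n.
have := dft_parseval M_gt0 (fun n : 'I_M => dft_cis M y n).
under eq_bigr do rewrite dft_inversion// csq_cis.
rewrite sumr_const card_ord -[LHS]mulr1 => /(mulfI (lt0r_neq0 M_gt0R)) ->.
by rewrite (bigD1 n)//= lerDl sumr_ge0// => i _; exact: csq_ge0.
Qed.

(** The coefficient is a geometric sum of ratio [cis ((y - n) / M)], that is a
Dirichlet kernel: it decays like the inverse of the cyclic distance from [n] to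
[y] modulo [M], uniformly in [M]. *)
Lemma csq_dft_le (k M : nat) (y T : R) (n : nat) :
  0 < T -> T + 1 <= y -> y <= k%:R - T - 1 -> (k <= n < M)%N ->
  csq (dft_cis M y n) <= ((n%:R - y) ^+ 2)^-1 + ((M%:R - n%:R + y) ^+ 2)^-1.
Proof.
move=> T_gt0 y_ge y_le /andP[kn nM].
have M_gt0 : (0 < M)%N by apply: leq_ltn_trans nM.
have M_gt0R : 0 < M%:R :> R by rewrite ltr0n.
have knR : k%:R <= n%:R :> R by rewrite ler_nat.
have nMR : n%:R < M%:R :> R by rewrite ltr_nat.
have n0 := ler0n R n.
pose x : R := (n%:R - y) / M%:R.
have x01 : 0 < x < 1.
  apply/andP; split; first by rewrite divr_gt0//; lra.
  by rewrite ltr_pdivrMr// mul1r; lra.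
have E : dft_cis M y n = M%:R^-1 * conjc (\sum_(c < M) cis (x * c%:R)).
  rewrite /dft_cis /dft rmorph_sum; congr (_ * _); apply: eq_bigr => c _.
  rewrite /chi -[RHS]/(conjc _) -!cisN -cisD; congr cis; rewrite /x; field.
  by rewrite gt_eqF.
have E2 : csq (dft_cis M y n) * csq (1 - cis x) = M%:R^-2 * csq (1 - cis (x * M%:R)).
  rewrite E csqM csqJ -mulrA -csqM geometric_cis; congr (_ * _).
  by rewrite -(rmorph_nat (real_complex R)) -fmorphV csq_real exprVn.
have le4 : csq (1 - cis (x * M%:R)) <= 4.
  have := csqD_le 1 (- cis (x * M%:R)); rewrite csqN csq_cis.
  by rewrite -(cis0 R) csq_cis; lra.
have p0 : 0 < csq (1 - cis x).
  rewrite lt_neqAle csq_ge0 andbT eq_sym csq_eq0 subr_eq0 eq_sym.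
  by move: (x01) => /andP[x0 x1]; rewrite cis_neq1// gtr0_norm// x0.
have -> : csq (dft_cis M y n) =
    M%:R^-2 * csq (1 - cis (x * M%:R)) * (csq (1 - cis x))^-1.
  by rewrite -E2 mulfK ?gt_eqF.
apply: (@le_trans _ _ (M%:R^-2 * 4 * (4^-1 * ((x ^+ 2)^-1 + ((1 - x) ^+ 2)^-1)))).
  apply: ler_pM.
  - by rewrite mulr_ge0 ?csq_ge0// invr_ge0 exprn_ge0.
  - by rewrite invr_ge0 csq_ge0.
  - by rewrite ler_wpM2l// invr_ge0 exprn_ge0.
  - exact: csq_1Bcis_inv.
rewrite le_eqVlt; apply/orP; left; apply/eqP; rewrite /x; field.
by repeat (apply/andP; split); rewrite ?gt_eqF//; lra.
Qed.

(** By Parseval the mean square error is the sum of the squares of the discarded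
coefficients. Each is bounded by the increment of [h], so that the sum
telescopes, and only the distance [T] from [y] to the ends of the window
[[0, k]] remains. The bound [2 / T] on the mean does not depend on [M]. *)
Lemma dft_tail (k M : nat) (y T : R) : (0 < M)%N -> (k <= M)%N ->
  0 < T -> T + 1 <= y -> y <= k%:R - T - 1 ->
  \sum_(c < M) csq (cis (y * (c%:R / M%:R)) -
    \sum_(n < k) dft_cis M y n * chi R M n c) <= M%:R * (2 / T).
Proof.
move=> M_gt0 kM T_gt0 y_ge y_le.
have M_gt0R : 0 < M%:R :> R by rewrite ltr0n.
pose v (c : 'I_M) : R[i] := cis (y * (c%:R / M%:R)).
have E (c : 'I_M) : v c - \sum_(n < k) dft_cis M y n * chi R M n c =
    \sum_(n < M) (if (k <= n)%N then dft_cis M y n else 0) * chi R M n c.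
  rewrite -{1}(dft_inversion M_gt0 v c).
  rewrite (big_ord_widen _ (fun n => dft_cis M y n * chi R M n c) kM).
  rewrite [X in X - _](bigID (fun n : 'I_M => (n < k)%N)) addrAC subrr add0r.
  rewrite big_mkcond; apply: eq_bigr => n _; rewrite andTb -leqNgt.
  by case: ifP => //; rewrite mul0r.
under eq_bigr do rewrite E.
rewrite dft_parseval// ler_pM2l//.
pose h (n : nat) : R := (M%:R - n%:R + y)^-1 - (n%:R - y - 1)^-1.
apply: (@le_trans _ _ (\sum_(n < M | (k <= n)%N) (h n.+1 - h n))).
  rewrite [leRHS]big_mkcond /=; apply: ler_sum => n _.
  case: ifP => kn; last by rewrite csq0.
  have nM := ltn_ord n.
  have knR : k%:R <= n%:R :> R by rewrite ler_nat.
  have nMR : n%:R + 1 <= M%:R :> R by rewrite natr1 ler_nat.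
  apply: le_trans (csq_dft_le T_gt0 y_ge y_le _) _; first by rewrite kn.
  rewrite /h -natr1.
  have H1 := @inv_sqr_telescope (n%:R - y).
  have H2 := @inv_sqr_telescope (M%:R - n%:R + y).
  have -> : M%:R - (n%:R + 1) + y = M%:R - n%:R + y - 1 by ring.
  have -> : n%:R + 1 - y - 1 = n%:R - y by ring.
  move: H1 H2; set a := _^-1; set b := _^-1; set c := _^-1.
  set a' := _^-1; set b' := _^-1; set c' := _^-1.
  move=> H1 H2; have := H1; have := H2; lra.
rewrite -(big_mkord (fun n => (k <= n)%N) (fun n => h n.+1 - h n)).
rewrite -(big_nat_widenl k 0 M predT (fun n => h n.+1 - h n)) ?leq0n//.
rewrite telescope_sumr// /h.
have kMR : k%:R <= M%:R :> R by rewrite ler_nat.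
have inv_le (z : R) : T <= z -> z^-1 <= T^-1.
  by move=> Tz; rewrite lef_pV2 ?posrE//; lra.
have H1 : (M%:R - M%:R + y)^-1 <= T^-1 by apply: inv_le; lra.
have H2 : (k%:R - y - 1)^-1 <= T^-1 by apply: inv_le; lra.
have H3 : 0 <= (M%:R - y - 1)^-1 by rewrite invr_ge0; lra.
have H4 : 0 <= (M%:R - k%:R + y)^-1 by rewrite invr_ge0; lra.
lra.
Qed.

End Tail.

Section Cells.
Variable R : realType.

Lemma normc_sum (I : Type) (r : seq I) (P : pred I) (F : I -> R[i]) :
  Normc.normc (\sum_(i <- r | P i) F i) <= \sum_(i <- r | P i) Normc.normc (F i).
Proof.
elim/big_ind2 : _ => [|x1 x2 y1 y2 H1 H2|//]; first by rewrite Normc.normc0.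
by rewrite (le_trans (le_normcD _ _))// lerD.
Qed.

Lemma normc_ge0 (z : R[i]) : 0 <= Normc.normc z.
Proof. by case: z => a b /=; exact: sqrtr_ge0. Qed.

Definition trig_error (k : nat) (y : R) (a : nat -> R[i]) (t : R) : R[i] :=
  cis (y * t) - \sum_(n < k) a n * cis (n%:R * t).

Lemma trig_error_lipschitz (k : nat) (y : R) (a : nat -> R[i]) (s t : R) :
  0 <= y -> (forall n, (n < k)%N -> csq (a n) <= 1) ->
  Normc.normc (trig_error k y a s - trig_error k y a t) <=
    (2 * pi * (y + \sum_(n < k) n%:R)) * `|s - t|.
Proof.
move=> y0 a1.
have -> : trig_error k y a s - trig_error k y a t =
    (cis (y * s) - cis (y * t)) +
    (- \sum_(n < k) a n * (cis (n%:R * s) - cis (n%:R * t))).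
  rewrite (eq_bigr (fun n : 'I_k => a n * cis (n%:R * s) - a n * cis (n%:R * t)));
    last by move=> n _; rewrite mulrBr.
  by rewrite sumrB /trig_error; ring.
apply: le_trans (le_normcD _ _) _.
rewrite mulrDr mulrDl; apply: lerD.
  apply: le_trans (normc_cisB _ _) _.
  by rewrite -mulrBr normrM (ger0_norm y0) !mulrA.
rewrite normcN; apply: le_trans (normc_sum _ _ _) _.
rewrite mulr_sumr mulr_suml; apply: ler_sum => n _.
rewrite Normc.normcM; apply: (@le_trans _ _ (1 * (2 * pi * `|n%:R * s - n%:R * t|))).
  apply: ler_pM; rewrite ?normc_ge0//; last exact: normc_cisB.
  by rewrite -(@ler_sqr _ _ 1) ?nnegrE ?normc_ge0// csqE expr1n a1.
by rewrite mul1r -mulrBr normrM ger0_norm// !mulrA.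
Qed.

(** From the grid to the interval: the coefficients come from the discrete
transform on [M] points, and [M] is taken so large that the Lipschitz constant
[L] of the error is negligible on each of the [M] cells. The constant [5] is
[2 * 2] from the error [2 / T] at the grid points, doubled by [csqD_le], plus
[1] for the variation within the cells. *)
Lemma trig_approx (k : nat) (y T : R) :
  0 < T -> T + 1 <= y -> y <= k%:R - T - 1 ->
  exists (M : nat) (a : nat -> R[i]) (w : 'I_M -> R),
  [/\ (0 < M)%N, forall c, 0 <= w c, \sum_c w c <= M%:R * (5 / T) &
    forall (c : 'I_M) (t : R), c%:R / M%:R <= t <= (c%:R + 1) / M%:R ->
      csq (trig_error k y a t) <= w c].
Proof.
move=> T0 yT yk.
pose L : R := 2 * pi * (y + \sum_(n < k) n%:R).
have y0 : 0 <= y by lra.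
have L0 : 0 <= L by rewrite !mulr_ge0 ?pi_ge0 ?addr_ge0 ?sumr_ge0.
pose M := (k + (Num.truncn (2 * T * L ^+ 2)).+1)%N.
have M0 : (0 < M)%N by rewrite /M addnS.
have kM : (k <= M)%N by rewrite leq_addr.
have M0R : 0 < M%:R :> R by rewrite ltr0n.
have LM : 2 * T * L ^+ 2 <= M%:R.
  apply: le_trans (ltW (truncnS_gt _)) _.
  by rewrite ler_nat leq_addl.
have M1 : 1 <= M%:R :> R by rewrite ler1n.
have LM2 : 2 * (L / M%:R) ^+ 2 <= T^-1.
  rewrite expr_div_n mulrA ler_pdivrMr ?exprn_gt0// ler_pdivlMl//.
  rewrite (_ : T * (2 * L ^+ 2) = 2 * T * L ^+ 2); last by ring.
  by apply: le_trans LM _; rewrite expr2; nra.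
pose a := dft_cis M y.
have a1 n : (n < k)%N -> csq (a n) <= 1.
  by move=> nk; have := @csq_dft_le1 _ M y (Ordinal (leq_trans nk kM)).
pose w (c : 'I_M) := 2 * csq (trig_error k y a (c%:R / M%:R)) + 2 * (L / M%:R) ^+ 2.
exists M, a, w; split => //.
- move=> c; rewrite /w; apply: addr_ge0; apply: mulr_ge0 => //.
    exact: csq_ge0.
  exact: sqr_ge0.
- rewrite big_split /= -mulr_sumr sumr_const card_ord.
  have := dft_tail M0 kM T0 yT yk.
  under eq_bigr => c _.
    under eq_bigr => n _ do rewrite /chi -mulrA.
    over.
  rewrite -/a => H; apply: (@le_trans _ _ (2 * (M%:R * (2 / T)) + M%:R * T^-1)).
    apply: lerD; first by rewrite ler_pM2l.
    by rewrite -[leLHS]mulr_natl ler_pM2l.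
  by rewrite le_eqVlt; apply/orP; left; apply/eqP; field; rewrite gt_eqF.
- move=> c t /andP[t1 t2].
  rewrite -[trig_error k y a t](subrK (trig_error k y a (c%:R / M%:R))) addrC.
  apply: le_trans (csqD_le _ _) _; rewrite /w lerD2l ler_pM2l// -csqE.
  rewrite ler_sqr ?nnegrE ?normc_ge0 ?divr_ge0//.
  apply: le_trans (trig_error_lipschitz _ _ y0 a1) _.
  rewrite -/L; apply: ler_wpM2l => //.
  by rewrite ger0_norm ?subr_ge0// lerBlDl; move: t2; rewrite mulrDl mul1r.
Qed.

End Cells.

(** * Measurability of complex functions, and covers by intervals *)

Section ComplexMeasurable.
Context d (T : measurableType d) (R : realType).
Implicit Types (D : set T) (f g : T -> R[i]).

Lemma cmeasurable_cst D (z : R[i]) : cmeasurable_fun D (fun=> z).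
Proof. by split; exact: measurable_cst. Qed.

Lemma cmeasurable_indic D E : measurable E ->
  cmeasurable_fun D (fun t => (\1_E t : R)%:C%C).
Proof.
move=> mE; split; last exact: measurable_cst.
by have := @measurable_indic _ T R D E mE.
Qed.

Lemma cmeasurableM D f g : cmeasurable_fun D f -> cmeasurable_fun D g ->
  cmeasurable_fun D (fun t => f t * g t).
Proof.
move=> [f1 f2] [g1 g2]; split.
  under eq_fun do rewrite Re_mulc.
  by apply: measurable_funB; exact: measurable_funM.
under eq_fun do rewrite Im_mulc.
by apply: measurable_funD; exact: measurable_funM.
Qed.

Lemma cmeasurableB D f g : cmeasurable_fun D f -> cmeasurable_fun D g ->
  cmeasurable_fun D (fun t => f t - g t).
Proof.
move=> [f1 f2] [g1 g2]; have ReN z : complex.Re (- z : R[i]) = - complex.Re z.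
  by case: z.
have ImN z : complex.Im (- z : R[i]) = - complex.Im z by case: z.
split; under eq_fun do rewrite ?Re_addc ?Im_addc ?ReN ?ImN.
  exact: measurable_funB.
exact: measurable_funB.
Qed.

Lemma cmeasurable_conj D f : cmeasurable_fun D f ->
  cmeasurable_fun D (fun t => conjc (f t)).
Proof.
move=> [f1 f2]; split; under eq_fun.
- by move=> t; rewrite (_ : complex.Re _ = complex.Re (f t)); [over|case: (f t)].
- exact: f1.
- by move=> t; rewrite (_ : complex.Im _ = - complex.Im (f t)); [over|case: (f t)].
- exact: measurableT_comp f2.
Qed.

Lemma cmeasurable_sum D (I : Type) (s : seq I) (h : I -> T -> R[i]) :
  (forall i, cmeasurable_fun D (h i)) ->
  cmeasurable_fun D (fun t => \sum_(i <- s) h i t).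
Proof.
move=> mh; split.
  by under eq_fun do rewrite Re_sum; apply: measurable_sum => i; case: (mh i).
by under eq_fun do rewrite Im_sum; apply: measurable_sum => i; case: (mh i).
Qed.

Lemma cmeasurable_csq D f : cmeasurable_fun D f ->
  measurable_fun D (fun t => csq (f t)).
Proof. by move=> [f1 f2]; apply: measurable_funD; exact: measurable_funX. Qed.

Lemma cmeasurable_subset D E f : measurable E -> D `<=` E ->
  cmeasurable_fun E f -> cmeasurable_fun D f.
Proof. by move=> mE DE [f1 f2]; split; exact: measurable_funS DE _. Qed.

End ComplexMeasurable.

Section CompletedLebesgue.
Variable R : realType.
Local Notation mu := (@completed_lebesgue_measure R).

Lemma borel_lebesgue_measurable (A : set R) :
  measurable (A : set (measurableTypeR R)) -> lebesgue_measurable A.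
Proof. exact: sub_caratheodory. Qed.

Lemma itv_lebesgue_measurable (i : interval R) : lebesgue_measurable [set` i].
Proof. by apply: borel_lebesgue_measurable; exact: measurable_itv. Qed.

Lemma continuous_lebesgue_measurable (f : R -> R) : continuous f ->
  measurable_fun (setT : set (lebesgueTypeR R)) (f : lebesgueTypeR R -> R).
Proof.
move=> cf _ B mB; rewrite setTI.
have /(_ measurableT B mB) := continuous_measurable_fun cf.
by rewrite setTI; exact: borel_lebesgue_measurable.
Qed.

Lemma completed_lebesgue_measure_itv (a b : R) : a <= b ->
  mu `]a, b]%classic = (b - a)%:E.
Proof.
move=> ab; rewrite -[LHS]/(lebesgue_measure `]a, b]%classic).
rewrite lebesgue_measure_itv/= lte_fin; case: ltgtP ab => // ->.
by rewrite subrr.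
Qed.

Lemma cmeasurable_cis (D : set (lebesgueTypeR R)) (u v : R) :
  cmeasurable_fun D (fun t : lebesgueTypeR R => cis (u * t + v)).
Proof.
apply: (@cmeasurable_subset _ _ _ _ setT) => //.
have c (f : R -> R) : continuous f ->
    continuous (fun t => f (2 * pi * (u * t + v) * 1)).
  move=> cf t; apply: (@continuous_comp _ _ _ (fun t => 2 * pi * (u * t + v) * 1) f).
    apply: cvgM; last exact: cvg_cst.
    apply: cvgM; first exact: cvg_cst.
    apply: cvgD; last exact: cvg_cst.
    by apply: cvgM; [exact: cvg_cst|exact: cvg_id].
  exact: cf.
split; apply: (continuous_lebesgue_measurable (c _ _)).
  by move=> t; exact: continuous_cos.
by move=> t; exact: continuous_sin.
Qed.

(** The completed measure is the outer measure generated by interval lengths, so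
countably many intervals of total length at most [mu S + e] cover [S]; what the
first [n] of them miss decreases to the empty set. *)
Lemma finite_interval_cover (S : set R) (e : R) : lebesgue_measurable S ->
  (mu S < +oo)%E -> 0 < e ->
  exists (n : nat) (a b : nat -> R),
  [/\ forall k, a k <= b k,
      ((\sum_(k < n) (b k - a k))%:E <= mu S + e%:E)%E &
      (mu (S `\` \big[setU/set0]_(k < n) `]a k, b k]%classic) <= e%:E)%E].
Proof.
move=> mS Sfin e0.
have muSfin : mu S \is a fin_num by rewrite ge0_fin_numE.
have [_ [A [mA SA] <-] Alt] := lb_ereal_inf_adherent e0 muSfin.
have abP k : exists ab : R * R, ab.1 <= ab.2 /\ A k = `]ab.1, ab.2]%classic.
  have [[x y] _ <-] := mA k.
  have [xy|yx] := leP x y; first by exists (x, y).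
  exists (x, x); split=> //=; rewrite set_itvoc0.
  by rewrite set_itv_ge// bnd_simp -leNgt ltW.
have [ab abE] := choice abP.
have mAc k : lebesgue_measurable (A k).
  by rewrite (abE k).2; exact: itv_lebesgue_measurable.
have muA k : mu (A k) = ((ab k).2 - (ab k).1)%:E.
  by rewrite (abE k).2 completed_lebesgue_measure_itv// (abE k).1.
have wA k : wlength idfun (A k) = mu (A k).
  by rewrite -[RHS]/((wlength idfun)^*%mu (A k)) measurable_mu_extE.
pose F n : set (lebesgueTypeR R) := S `\` \big[setU/set0]_(k < n) A k.
have mF n : measurable (F n).
  by apply: measurableD => //; apply: bigsetU_measurable => k _; exact: mAc.
have Fcap : \bigcap_n F n = set0.
  rewrite -subset0 => x Fx; have [k _ Akx] := SA _ (Fx 0%N I).1.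
  by apply: (Fx k.+1 I).2; rewrite big_ord_recr; right.
have Flim : (mu \o F) x @[x --> \oo] --> 0%E.
  rewrite -(measure0 mu) -Fcap; apply: nonincreasing_cvg_mu => //.
  - by rewrite /F big_ord0 setD0.
  - by rewrite Fcap.
  - move=> n m nm; apply/subsetPset => x [Sx Ux]; split=> //; apply: contra_not Ux.
    exact: subset_bigsetU.
have [n Fn] : exists n, (mu (F n) < e%:E)%E.
  apply: contrapT => /forallNP nF.
  have : (e%:E <= lim ((mu \o F) x @[x --> \oo]))%E.
    apply: lime_ge; first by apply/cvg_ex; exists 0%E.
    by apply: nearW => n; rewrite leNgt; apply/negP/nF.
  by rewrite (cvg_lim _ Flim)// lee_fin leNgt e0.
exists n, (fun k => (ab k).1), (fun k => (ab k).2); split => [k||].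
- exact: (abE k).1.
- rewrite -sumEFin; under eq_bigr do rewrite -muA -wA.
  apply: le_trans (ltW Alt).
  rewrite -(big_mkord xpredT (fun k => wlength idfun (A k))).
  exact: nneseries_lim_ge.
- apply: le_trans (ltW Fn); rewrite /F.
  by under eq_bigr do rewrite -(abE _).2.
Qed.

End CompletedLebesgue.

(** * Families of functions approximable with a given time-frequency budget *)

(** An upper Riemann sum. *)
Lemma integral_le_cells d (X : measurableType d) (R : realType)
    (mu : {measure set X -> \bar R}) (E : set X) (f : X -> R) (I : finType)
    (cell : I -> set X) (w : I -> R) (h : R) :
  measurable E -> measurable_fun E f -> (forall t, E t -> 0 <= f t) ->
  (forall c, measurable (cell c)) -> (forall c, (mu (cell c) <= h%:E)%E) ->
  (forall c, 0 <= w c) ->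
  (forall t, E t -> exists2 c, cell c t & f t <= w c) ->
  (\int[mu]_(t in E) (f t)%:E <= ((\sum_c w c) * h)%:E)%E.
Proof.
move=> mE mf f0 mcell mucell w0 fw.
apply: (@le_trans _ _ (\int[mu]_(t in E) (\sum_c (w c * \1_(cell c) t)%:E))%E).
  apply: ge0_le_integral => //.
  - exact/measurable_EFinP.
  - apply: emeasurable_sum => c; apply/measurable_EFinP.
    by apply: measurable_funM => //; exact: measurable_indic.
  move=> t Et; have [c ct ftw] := fw t Et.
  rewrite sumEFin lee_fin (bigD1 c)//= [\1__ _]indicE mem_set// mulr1.
  rewrite -[leLHS]addr0; apply: lerD => //.
  by apply: sumr_ge0 => i _; rewrite mulr_ge0// indicE.
rewrite ge0_integral_sum//; last 2 first.
- move=> c; apply/measurable_EFinP.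
  by apply: measurable_funM => //; exact: measurable_indic.
- by move=> c t _; rewrite lee_fin mulr_ge0// indicE.
rewrite mulr_suml -sumEFin; apply: lee_sum => c _.
under eq_integral do rewrite EFinM.
rewrite ge0_integralZl_EFin//; last first.
  by apply/measurable_EFinP; exact: measurable_indic.
rewrite integral_indic// EFinM; apply: lee_wpmul2l; first by rewrite lee_fin.
apply: le_trans (mucell c); apply: le_measure; rewrite ?inE//.
exact: measurableI.
Qed.

Section Approximable.
Context d (X : measurableType d) (R : realType).
Variables (mu : {measure set X -> \bar R}) (ef : R -> X -> R[i]).

Definition approx_error (J : finType) (phi : J -> X -> R[i]) (c : J -> R[i])
    (g : R) (t : X) : R[i] :=
  ef g t - \sum_j c j * phi j t.

(** Uniformly in [x], the [ef g] with [g] in a window [[x, x + r]] are within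
[e], in squared norm on [E], of a space of dimension at most
[rho * r + O(1)]. The density [rho] is the quantity that matters; the constant
[C] may depend on [e]. *)
Definition approximable (E : set X) (rho e : R) : Prop :=
  exists C : R, forall x r : R, 0 <= r ->
  exists (J : finType) (phi : J -> X -> R[i]),
  [/\ #|J|%:R <= rho * r + C,
      forall j, cmeasurable_fun setT (phi j),
      forall j t, csq (phi j t) <= 1 &
      forall g, x <= g <= x + r -> exists c : J -> R[i],
        (\int[mu]_(t in E) (csq (approx_error phi c g t))%:E <= e%:E)%E].

Hypothesis mef : forall g, cmeasurable_fun setT (ef g).
Hypothesis ef1 : forall g t, csq (ef g t) = 1.

Lemma cmeasurable_approx_error (D : set X) (J : finType) (phi : J -> X -> R[i])
    (c : J -> R[i]) (g : R) :
  (forall j, cmeasurable_fun setT (phi j)) ->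
  cmeasurable_fun D (approx_error phi c g).
Proof.
move=> mphi.
have mS : cmeasurable_fun setT (fun t : X => \sum_j c j * phi j t).
  by apply: cmeasurable_sum => j; apply: cmeasurableM => //; exact: cmeasurable_cst.
have [m1 m2] := cmeasurableB (mef g) mS.
by split; [exact: measurable_funS m1|exact: measurable_funS m2].
Qed.

Lemma approximable_le (E : set X) (rho rho' e e' : R) :
  rho <= rho' -> e <= e' -> approximable E rho e -> approximable E rho' e'.
Proof.
move=> rr ee [C H]; exists C => x r r0.
have [J [phi [cJ mphi bphi ephi]]] := H x r r0.
exists J, phi; split => //.
  by apply: le_trans cJ _; rewrite lerD2r ler_wpM2r.
move=> g /ephi[c gc]; exists c; apply: le_trans gc _; by rewrite lee_fin.
Qed.

(** On a set of measure at most [e], zero is a good enough approximation. *)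
Lemma approximable_small (E : set X) (e : R) :
  measurable E -> (mu E <= e%:E)%E -> approximable E 0 e.
Proof.
move=> mE Ee; exists 0 => x r r0; exists void, (fun _ _ => 0); split => //.
  by rewrite card_void mul0r addr0.
move=> g _; exists (fun=> 0); apply: le_trans Ee.
rewrite (eq_integral (cst 1%E)) ?integral_cst ?mul1e// => t _.
by rewrite /approx_error big1 ?subr0 ?ef1//; case.
Qed.

(** Cut off the approximating functions of each part by its indicator: errors
and dimensions both add up. *)
Lemma approximableU (E E' : set X) (rho rho' e e' : R) :
  measurable E -> measurable E' -> E `&` E' = set0 ->
  approximable E rho e -> approximable E' rho' e' ->
  approximable (E `|` E') (rho + rho') (e + e').
Proof.
move=> mE mE' EE' [C H] [C' H']; exists (C + C') => x r r0.
have [J [phi [cJ mphi bphi ephi]]] := H x r r0.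
have [J' [phi' [cJ' mphi' bphi' ephi']]] := H' x r r0.
pose psi (j : J + J') : X -> R[i] :=
  match j with
  | inl j => fun t => phi j t * (\1_E t)%:C%C
  | inr j => fun t => phi' j t * (\1_E' t)%:C%C
  end.
have mpsi j : cmeasurable_fun setT (psi j).
  case: j => j.
    by have := cmeasurableM (mphi j) (@cmeasurable_indic _ X R setT _ mE).
  by have := cmeasurableM (mphi' j) (@cmeasurable_indic _ X R setT _ mE').
exists (J + J')%type, psi; split => //.
- by rewrite card_sum natrD; lra.
- have b1 (z : R[i]) (b : bool) : csq z <= 1 -> csq (z * (b%:R)%:C%C) <= 1.
    move=> z1; rewrite csqM csq_real; case: b; first by rewrite expr1n mulr1.
    by rewrite expr0n mulr0.
  by case=> j t; rewrite /psi indicE; exact: b1.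
move=> g gx; have [c ec] := ephi g gx; have [c' ec'] := ephi' g gx.
exists (fun j => match j with inl j => c j | inr j => c' j end).
rewrite ge0_integral_setU//; last 3 first.
- exact/measurable_EFinP/cmeasurable_csq/cmeasurable_approx_error.
- by move=> t _; rewrite lee_fin csq_ge0.
- by apply/disj_setPS; rewrite EE'.
rewrite EFinD; apply: leeD.
- rewrite (eq_integral (fun t => (csq (approx_error phi c g t))%:E))// => t.
  rewrite inE => Et; congr (csq (_ - _))%:E; rewrite big_sumType/= [X in _ + X]big1.
    by rewrite addr0; apply: eq_bigr => j _; rewrite indicE mem_set// mulr1.
  move=> j _; rewrite indicE memNset ?mulr0// => E't.
  by have : (E `&` E') t by []; rewrite EE'.
- rewrite (eq_integral (fun t => (csq (approx_error phi' c' g t))%:E))// => t.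
  rewrite inE => Et; congr (csq (_ - _))%:E; rewrite big_sumType/= [X in X + _]big1.
    by rewrite add0r; apply: eq_bigr => j _; rewrite indicE mem_set// mulr1.
  move=> j _; rewrite indicE memNset ?mulr0// => E't.
  by have : (E `&` E') t by []; rewrite EE'.
Qed.

End Approximable.

Section ExponentialsApproximable.
Variable R : realType.
Local Notation mu := (@completed_lebesgue_measure R).
Local Notation X := (lebesgueTypeR R).
Local Notation exp_approx := (approximable mu (@expi R : R -> X -> R[i])).

Lemma cmeasurable_expi (g : R) : cmeasurable_fun setT (expi g : X -> R[i]).
Proof.
rewrite (_ : expi g = fun t => cis (g * t + 0)); first exact: cmeasurable_cis.
by apply/funext => t; rewrite addr0 expiE.
Qed.

Lemma csq_expi (g : R) (t : X) : csq (expi g t) = 1.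
Proof. by rewrite expiE csq_cis. Qed.

Lemma cell_of (M : nat) (t : R) : 0 < t <= 1 -> (0 < M)%N ->
  exists c : 'I_M, c%:R / M%:R < t <= (c%:R + 1) / M%:R.
Proof.
move=> /andP[t0 t1] M0; have M0R : 0 < M%:R :> R by rewrite ltr0n.
have ex : exists n : nat, t * M%:R <= n.+1%:R.
  by exists M.-1; rewrite prednK// ger_pMl.
have [n tn nmin] := ex_minnP ex.
have nM : (n < M)%N.
  by rewrite -(prednK M0) ltnS; apply: nmin; rewrite prednK// ger_pMl.
exists (Ordinal nM); rewrite /= ltr_pdivrMr// ler_pdivlMr// natr1 tn andbT.
case: n nmin {tn nM} => [|n] nmin; first by rewrite mulr_gt0.
by rewrite ltNge; apply/negP => /nmin; rewrite ltnn.
Qed.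

(** After rescaling to the unit interval, the frequencies of the window fill an
interval of length [l * r], and [trig_approx] handles all of them with the
integer frequencies (shifted by [n0]) of that interval enlarged by [T + 1] on
both sides. The enlargement depends on [e] but not on [r], so it only
contributes to the constant. *)
Lemma exp_approx_itv (E : set X) (a b e : R) : measurable E -> a <= b ->
  E `<=` `]a, b]%classic -> 0 < e -> exp_approx E (b - a) e.
Proof.
move=> mE ab Eab e0.
have [ba|ba] := eqVneq a b.
  rewrite ba subrr; apply: (approximable_small csq_expi) => //.
  have -> : E = set0.
    rewrite -subset0 => t /Eab; rewrite ba /= in_itv/= => /andP[bt tb].
    by move: (lt_le_trans bt tb); rewrite ltxx.
  by rewrite measure0 lee_fin ltW.
pose l := b - a.
have l0 : 0 < l by rewrite subr_gt0 lt_neqAle ba.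
(* makes the error [5 / T * l] of [trig_approx] equal to [e] *)
pose T := 5 * l / e.
have T0 : 0 < T by rewrite divr_gt0// mulr_gt0.
exists (2 * T + 3) => x r r0.
pose n0 := x * l - T - 1.
pose k := (Num.truncn (l * r + 2 * T + 2)).+1.
have lr0 : 0 <= l * r + 2 * T + 2.
  by have := mulr_ge0 (ltW l0) r0; lra.
have /andP[k1 k2] := truncn_itv lr0.
exists 'I_k, (fun (n : 'I_k) t => cis ((n0 + n%:R) / l * t + - ((n0 + n%:R) / l * a))).
split.
- by rewrite card_ord /k -natr1 -/l; lra.
- by move=> j; exact: cmeasurable_cis.
- by move=> j t; rewrite csq_cis.
move=> g /andP[g1 g2].
pose y := g * l - n0.
have y1 : T + 1 <= y by rewrite /y /n0; nra.
have y2 : y <= k%:R - T - 1 by rewrite /y /n0 /k; nra.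
have [M [cf [w [M0 w0 wsum wP]]]] := trig_approx T0 y1 y2.
have M0R : 0 < M%:R :> R by rewrite ltr0n.
exists (fun n : 'I_k => cis (g * a) * cf n).
set phi := (X in approx_error _ X).
pose cell (c : 'I_M) : set X :=
  `]a + l * (c%:R / M%:R), a + l * ((c%:R + 1) / M%:R)]%classic.
have mcell c : measurable (cell c) by exact: itv_lebesgue_measurable.
have mucell c : mu (cell c) = (l / M%:R)%:E.
  rewrite completed_lebesgue_measure_itv; first by congr EFin; field; rewrite gt_eqF.
  rewrite lerD2l ler_pM2l// ler_pM2r ?invr_gt0//; lra.
have errE t : approx_error (@expi R) phi (fun n : 'I_k => cis (g * a) * cf n) g t =
    cis (g * a) * cis (n0 * ((t - a) / l)) * trig_error k y cf ((t - a) / l).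
  rewrite /approx_error /trig_error mulrBr -cisD -cisD expiE; congr (cis _ - _).
    by rewrite /y; field; rewrite gt_eqF.
  rewrite mulr_sumr; apply: eq_bigr => n _.
  rewrite /phi -mulrA [RHS]mulrCA [in LHS]mulrCA; congr (_ * _).
  by rewrite -!cisD; congr cis; field; rewrite gt_eqF.
have merr : measurable_fun E
    (fun t => csq (approx_error (@expi R) phi
      (fun n : 'I_k => cis (g * a) * cf n) g t)).
  apply: cmeasurable_csq; apply: (cmeasurable_approx_error cmeasurable_expi) => j.
  exact: cmeasurable_cis.
have err0 t : E t ->
    0 <= csq (approx_error (@expi R) phi (fun n : 'I_k => cis (g * a) * cf n) g t).
  by rewrite csq_ge0.
have mucell' c : (mu (cell c) <= (l / M%:R)%:E)%E by rewrite mucell.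
apply: le_trans (integral_le_cells mE merr err0 mcell mucell' w0 _) _.
  move=> t /Eab; rewrite /= in_itv/= => /andP[at_ tb].
  have tau : 0 < (t - a) / l <= 1.
    apply/andP; split; first by rewrite divr_gt0// subr_gt0.
    by rewrite ler_pdivrMr// mul1r /l lerD2r.
  have [c c12] := cell_of tau M0; exists c.
    rewrite /cell /= in_itv/=.
    move: c12; rewrite ltr_pdivlMr// ler_pdivrMr// ltrBrDl lerBlDl.
    by rewrite ![_ * l]mulrC.
  rewrite errE !csqM !csq_cis !mul1r; apply: wP.
  by move: c12 => /andP[/ltW -> ->].
rewrite lee_fin.
apply: (@le_trans _ _ (M%:R * (5 / T) * (l / M%:R))).
  by rewrite ler_wpM2r// divr_ge0// ltW.
rewrite le_eqVlt; apply/orP; left; apply/eqP; rewrite /T; field.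
by rewrite !gt_eqF.
Qed.

Lemma exp_approx_cover (S : set X) (n : nat) (a b : nat -> R) (e : R) :
  measurable S -> (forall k, a k <= b k) -> 0 < e ->
  exp_approx (S `&` \big[setU/set0]_(k < n) `]a k, b k]%classic)
    (\sum_(k < n) (b k - a k)) (n%:R * e).
Proof.
move=> mS ab e0.
have mI k : measurable (`]a k, b k]%classic : set X).
  exact: itv_lebesgue_measurable.
elim: n => [|n IH].
  rewrite !big_ord0 setI0 mul0r; apply: (approximable_small csq_expi) => //.
  by rewrite measure0.
have mU : measurable (\big[setU/set0]_(k < n) `]a k, b k]%classic : set X).
  by apply: bigsetU_measurable => k _.
rewrite !big_ord_recr /=; set U := \big[setU/set0]_(k < n) _ in mU IH *.
have -> : S `&` (U `|` `]a n, b n]%classic) =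
    (S `&` U) `|` ((S `&` `]a n, b n]%classic) `\` U).
  apply/seteqP; split=> t.
    move=> [St [Ut|It]]; first by left.
    by have [Ut|nUt] := pselect (U t); [left|right].
  by move=> [[St Ut]|[[St It] _]]; split => //; [left|right].
rewrite -natr1 mulrDl mul1r; apply: (approximableU cmeasurable_expi) => //.
- exact: measurableI.
- by apply: measurableD => //; exact: measurableI.
- by rewrite -subset0 => t [[_ Ut] [_ /(_ Ut)]].
- apply: exp_approx_itv => //; last by move=> t [[]].
  by apply: measurableD => //; exact: measurableI.
Qed.

(** The intervals of [finite_interval_cover] are made disjoint one at a time;
the remainder of [S] has small measure. *)
Lemma exp_approx_finite_measure (S : set X) (e : R) :
  measurable S -> (mu S < +oo)%E -> 0 < e ->
  exp_approx S (fine (mu S) + e) e.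
Proof.
move=> mS Sfin e0.
have e20 : 0 < e / 2 by rewrite divr_gt0.
have [n [a [b [ab sumab muD]]]] := finite_interval_cover mS Sfin e20.
have e30 : 0 < e / 2 / n.+1%:R by rewrite divr_gt0.
have H := exp_approx_cover n mS ab e30.
set U := \big[setU/set0]_(k < n) _ in muD H.
have mU : measurable (U : set X).
  by apply: bigsetU_measurable => k _; exact: itv_lebesgue_measurable.
have H2 : exp_approx (S `\` U) 0 (e / 2).
  by apply: (approximable_small csq_expi) => //; exact: measurableD.
have := approximableU cmeasurable_expi _ _ _ H H2; rewrite setUIDK.
have muS : (mu S) = (fine (mu S))%:E by rewrite fineK// ge0_fin_numE.
move: sumab; rewrite muS -EFinD lee_fin => sumab K.
apply: approximable_le (K _ _ _).
- by rewrite addr0 (le_trans sumab)// lerD2l; lra.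
- rewrite [leRHS]splitr lerD2r mulrCA ger_pMr// ler_pdivrMr// mul1r ler_nat.
  exact: leqnSn.
- exact: measurableI.
- exact: measurableD.
- by rewrite -subset0 => t [[_ Ut] [_ /(_ Ut)]].
Qed.

End ExponentialsApproximable.

(** * Linearity of the complex integral *)

Lemma normr_mulD_le (R : realDomainType) (a b c e : R) :
  `|a * c + b * e| <= a ^+ 2 + b ^+ 2 + (c ^+ 2 + e ^+ 2).
Proof.
have := sqr_ge0 (a - c); have := sqr_ge0 (a + c); have := sqr_ge0 (b - e).
have := sqr_ge0 (b + e); have := sqr_ge0 a; have := sqr_ge0 b.
have := sqr_ge0 c; have := sqr_ge0 e => *.
by rewrite ler_norml; apply/andP; split; nra.
Qed.

Lemma normr_Re_mulJ_le (R : rcfType) (z w : R[i]) :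
  `|complex.Re (z * conjc w)| <= csq z + csq w.
Proof. by case: z w => a b [c e]; rewrite /= mulrN opprK; exact: normr_mulD_le. Qed.

Lemma normr_Im_mulJ_le (R : rcfType) (z w : R[i]) :
  `|complex.Im (z * conjc w)| <= csq z + csq w.
Proof.
case: z w => a b [c e]; rewrite Im_mulc /= [csq (c +i* e)%C]addrC -(sqrrN e).
exact: normr_mulD_le.
Qed.

Section ComplexIntegral.
Context d (X : measurableType d) (R : realType).
Variables (mu : {measure set X -> \bar R}) (D : set X).
Hypothesis mD : measurable D.
Implicit Types f g : X -> R[i].

Definition cintegrable f : Prop :=
  mu.-integrable D (EFin \o (fun t => complex.Re (f t))) /\
  mu.-integrable D (EFin \o (fun t => complex.Im (f t))).

Lemma cintegrableD f g : cintegrable f -> cintegrable g ->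
  cintegrable (fun t => f t + g t).
Proof.
move=> [f1 f2] [g1 g2]; split.
  rewrite (_ : EFin \o _ = (EFin \o (fun t => complex.Re (f t))) \+
      (EFin \o (fun t => complex.Re (g t))))%E; first exact: integrableD.
  by apply/funext => t /=; rewrite Re_addc.
rewrite (_ : EFin \o _ = (EFin \o (fun t => complex.Im (f t))) \+
    (EFin \o (fun t => complex.Im (g t))))%E; first exact: integrableD.
by apply/funext => t /=; rewrite Im_addc.
Qed.

Lemma integrableZR (k : R) (f : X -> R) : mu.-integrable D (EFin \o f) ->
  mu.-integrable D (EFin \o (fun t => k * f t)).
Proof. by move=> /(integrableZl mD k). Qed.

Lemma integrableBR (f g : X -> R) : mu.-integrable D (EFin \o f) ->
  mu.-integrable D (EFin \o g) -> mu.-integrable D (EFin \o (fun t => f t - g t)).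
Proof. by move=> f1 g1; have := integrableB mD f1 g1. Qed.

Lemma integrableDR (f g : X -> R) : mu.-integrable D (EFin \o f) ->
  mu.-integrable D (EFin \o g) -> mu.-integrable D (EFin \o (fun t => f t + g t)).
Proof. by move=> f1 g1; have := integrableD mD f1 g1. Qed.

Lemma cintegrableZ (z : R[i]) f : cintegrable f -> cintegrable (fun t => z * f t).
Proof.
move=> [f1 f2]; split.
  under [X in mu.-integrable D (EFin \o X)]eq_fun do rewrite Re_mulc.
  by apply: integrableBR; exact: integrableZR.
under [X in mu.-integrable D (EFin \o X)]eq_fun do rewrite Im_mulc.
by apply: integrableDR; exact: integrableZR.
Qed.

Lemma cintegralD f g : cintegrable f -> cintegrable g ->
  cintegral mu D (fun t => f t + g t) = cintegral mu D f + cintegral mu D g.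
Proof.
move=> [f1 f2] [g1 g2]; rewrite /cintegral; simpc; congr (_ +i* _)%C.
  by rewrite -RintegralD//; apply: eq_Rintegral => t _; rewrite Re_addc.
by rewrite -RintegralD//; apply: eq_Rintegral => t _; rewrite Im_addc.
Qed.

Lemma cintegralZ (z : R[i]) f : cintegrable f ->
  cintegral mu D (fun t => z * f t) = z * cintegral mu D f.
Proof.
move=> [f1 f2]; case: z => a b; rewrite /cintegral; simpc; congr (_ +i* _)%C.
  rewrite -!RintegralZl// -RintegralB//; [|exact: integrableZR|exact: integrableZR].
  by apply: eq_Rintegral => t _; rewrite Re_mulc.
rewrite -!RintegralZl// addrC -RintegralD//; [|exact: integrableZR|exact: integrableZR].
by apply: eq_Rintegral => t _; rewrite Im_mulc addrC.
Qed.

Lemma cintegral_lincomb (I : Type) (s : seq I) (z : I -> R[i]) (F : I -> X -> R[i]) :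
  (forall i, cintegrable (F i)) ->
  cintegrable (fun t => \sum_(i <- s) z i * F i t) /\
  cintegral mu D (fun t => \sum_(i <- s) z i * F i t) =
    \sum_(i <- s) z i * cintegral mu D (F i).
Proof.
move=> iF; elim: s => [|i s [IH1 IH2]].
  have E : (fun t : X => \sum_(i <- [::]) z i * F i t) = cst 0.
    by apply/funext => t; rewrite big_nil.
  rewrite E big_nil; split.
    by split; exact: (@integrable0 _ _ _ mu D).
  by rewrite /cintegral /= !Rintegral_cst// !mul0r.
have E : (fun t => \sum_(j <- i :: s) z j * F j t) =
    (fun t => z i * F i t + \sum_(j <- s) z j * F j t).
  by apply/funext => t; rewrite big_cons.
rewrite E big_cons; split.
  by apply: cintegrableD => //; exact: cintegrableZ.
by rewrite cintegralD ?cintegralZ ?IH2//; exact: cintegrableZ.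
Qed.

Definition sqint f : Prop :=
  cmeasurable_fun D f /\ (\int[mu]_(t in D) (csq (f t))%:E < +oo)%E.

Lemma sqint_integrable f : sqint f -> mu.-integrable D (EFin \o (fun t => csq (f t))).
Proof.
move=> [mf foo]; apply/integrableP; split.
  by apply/measurable_EFinP; exact: cmeasurable_csq.
rewrite (eq_integral (fun t => (csq (f t))%:E))// => t _ /=.
by rewrite ger0_norm// csq_ge0.
Qed.

Lemma sqint_bounded f (b : R) : (mu D < +oo)%E -> cmeasurable_fun D f ->
  (forall t, csq (f t) <= b) -> sqint f.
Proof.
move=> Doo mf fb; split => //.
apply: (@le_lt_trans _ _ (\int[mu]_(t in D) (cst b%:E t))%E).
  apply: ge0_le_integral => //.
  - by move=> t _; rewrite lee_fin csq_ge0.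
  - by apply/measurable_EFinP; exact: cmeasurable_csq.
  - by move=> t _; rewrite lee_fin.
have Dfin : mu D \is a fin_num by rewrite ge0_fin_numE.
by rewrite integral_cst// -(fineK Dfin) -EFinM ltry.
Qed.

Lemma sqint_mulJ f g : sqint f -> sqint g -> cintegrable (fun t => f t * conjc (g t)).
Proof.
move=> sf sg.
have [mr mi] := cmeasurableM sf.1 (cmeasurable_conj sg.1).
have ib : mu.-integrable D (EFin \o (fun t => csq (f t) + csq (g t))).
  by apply: integrableDR; exact: sqint_integrable.
split; apply: (le_integrable mD _ _ ib); try exact/measurable_EFinP.
- move=> t _ /=; rewrite lee_fin [leRHS]ger0_norm; last first.
    by apply: addr_ge0; exact: csq_ge0.
  exact: normr_Re_mulJ_le.
- move=> t _ /=; rewrite lee_fin [leRHS]ger0_norm; last first.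
    by apply: addr_ge0; exact: csq_ge0.
  exact: normr_Im_mulJ_le.
Qed.

End ComplexIntegral.

(** * The counting inequality *)

Section Counting.
Context d (X : measurableType d) (R : realType).
Variables (mu : {measure set X -> \bar R}) (S : set X) (ef : R -> X -> R[i]).

Lemma L2inner_approx (f : X -> R[i]) (g : R) (J : finType) (phi : J -> X -> R[i])
    (c : J -> R[i]) :
  measurable S -> sqint mu S f -> sqint mu S (approx_error ef phi c g) ->
  (forall j, sqint mu S (phi j)) ->
  L2inner mu S f (ef g) = L2inner mu S f (approx_error ef phi c g) +
    \sum_j conjc (c j) * L2inner mu S f (phi j).
Proof.
move=> mS sf se sphi.
have [i1 i2] := cintegral_lincomb mS (index_enum J) (fun j => conjc (c j))
  (fun j => sqint_mulJ mS sf (sphi j)).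
rewrite /L2inner -i2 -cintegralD//; last exact: sqint_mulJ.
congr (cintegral mu S); apply/funext => t.
rewrite /approx_error rmorphB rmorph_sum mulrBr mulr_sumr -addrA; apply/esym.
rewrite [X in _ + X](_ : _ = 0) ?addr0// addrC; apply/eqP.
rewrite subr_eq0; apply/eqP/eq_bigr => j _.
by rewrite rmorphM mulrCA.
Qed.

(** [projection_pairing] holds pointwise, with the same matrix [Q] at every
point, and only then is it integrated. So [tr (E Q)], for the matrix [E]
of inner products of [a] and [b], is bounded by the squared norms of the
individual functions, although [a] and [b] may be far from orthogonal systems. *)
Lemma projection_pairing_integral n (Q : 'M[R[i]]_n) (a b : 'I_n -> X -> R[i])
    (s A B : R) :
  measurable S -> map_mx Num.conj (Q^T) = Q -> Q *m Q = Q -> 0 < s ->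
  (forall i, sqint mu S (a i)) -> (forall j, sqint mu S (b j)) ->
  (forall i, (\int[mu]_(t in S) (csq (a i t))%:E <= A%:E)%E) ->
  (forall j, (\int[mu]_(t in S) (csq (b j t))%:E <= B%:E)%E) ->
  2 * complex.Re (\sum_i \sum_j L2inner mu S (a i) (b j) * Q j i) <=
    s * (n%:R * A) + s^-1 * (n%:R * B).
Proof.
move=> mS Qh QQ s0 sa sb aA bB.
pose F (p : 'I_n * 'I_n) (t : X) := a p.1 t * conjc (b p.2 t).
have iF p : cintegrable mu S (F p) by exact: sqint_mulJ.
have [i1 i2] := cintegral_lincomb mS (index_enum _) (fun p => Q p.2 p.1) iF.
have -> : \sum_i \sum_j L2inner mu S (a i) (b j) * Q j i =
    \sum_p Q p.2 p.1 * cintegral mu S (F p).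
  rewrite pair_big /=; apply: eq_bigr => p _; by rewrite mulrC.
rewrite -i2 /cintegral /= -RintegralZl//; last exact: i1.1.
have ia : mu.-integrable S (EFin \o (fun t => \sum_i csq (a i t))).
  rewrite (_ : _ \o _ = fun t => (\sum_i (csq (a i t))%:E)%E).
    by apply: integrable_sum => // i _; exact: sqint_integrable.
  by apply/funext => t; rewrite /= sumEFin.
have ib : mu.-integrable S (EFin \o (fun t => \sum_i csq (b i t))).
  rewrite (_ : _ \o _ = fun t => (\sum_i (csq (b i t))%:E)%E).
    by apply: integrable_sum => // i _; exact: sqint_integrable.
  by apply/funext => t; rewrite /= sumEFin.
have int_le (f : 'I_n -> X -> R[i]) (C : R) : (forall i, sqint mu S (f i)) ->
    (forall i, (\int[mu]_(t in S) (csq (f i t))%:E <= C%:E)%E) ->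
    \int[mu]_(t in S) (\sum_i csq (f i t)) <= n%:R * C.
  move=> sf fC; rewrite /Rintegral.
  under eq_integral do rewrite -sumEFin.
  rewrite (@integral_sum _ _ _ mu S mS _ (fun i t => (csq (f i t))%:E)); last first.
    by move=> i; exact: sqint_integrable.
  have le : (\sum_(i < n) \int[mu]_(t in S) (csq (f i t))%:E <= (n%:R * C)%:E)%E.
    apply: (@le_trans _ _ (\sum_(i < n) C%:E)%E); first exact: lee_sum.
    by rewrite sumEFin sumr_const card_ord mulr_natl.
  rewrite -lee_fin fineK// ge0_fin_numE ?(le_lt_trans le) ?ltry//.
  by apply: sume_ge0 => i _; apply: integral_ge0 => t _; rewrite lee_fin csq_ge0.
apply: (@le_trans _ _ (\int[mu]_(t in S)
    (s * \sum_i csq (a i t) + s^-1 * \sum_j csq (b j t)))).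
  apply: le_Rintegral => //.
  - by apply: integrableZR => //; exact: i1.1.
  - by apply: integrableDR => //; exact: integrableZR.
  - move=> t _.
    have := projection_pairing (fun i => a i t) (fun j => b j t) Qh QQ s0.
    rewrite pair_big /= => /(le_trans _); apply.
    rewrite le_eqVlt; apply/orP; left; apply/eqP; congr (2 * complex.Re _).
    by apply: eq_bigr => p _; rewrite mulrC.
rewrite RintegralD//; [|exact: integrableZR|exact: integrableZR].
rewrite !RintegralZl//; apply: lerD; apply: ler_wpM2l; rewrite ?invr_ge0 ?(ltW s0)//;
  exact: int_le.
Qed.

(** Replacing each [ef (gam j)] by its approximant in the span of [phi] turns
the matrix of inner products into one of rank at most [#|J|]. The discrepancy
[E] is controlled by [projection_pairing_integral] and the distance to the
identity [D] has squared Hilbert-Schmidt norm at most [n * d2], so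
[corank_le] applies. *)
Lemma counting_bound n (gam : 'I_n -> R) (f : 'I_n -> X -> R[i]) (B d2 eps s : R)
    (J : finType) (phi : J -> X -> R[i]) (c : 'I_n -> J -> R[i]) :
  measurable S -> (mu S < +oo)%E -> (forall g, cmeasurable_fun setT (ef g)) ->
  (forall i, sqint mu S (f i)) ->
  (forall i, (\int[mu]_(t in S) (csq (f i t))%:E <= B%:E)%E) ->
  (forall i, \sum_j csq (L2inner mu S (f i) (ef (gam j)) - (i == j)%:R) <= d2) ->
  (forall j, cmeasurable_fun setT (phi j)) -> (forall j t, csq (phi j t) <= 1) ->
  (forall i, (\int[mu]_(t in S)
     (csq (approx_error ef phi (c i) (gam i) t))%:E <= eps%:E)%E) ->
  0 < s ->
  n%:R * (1 - d2 - (s * B + s^-1 * eps)) <= #|J|%:R.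
Proof.
move=> mS Soo mef sf fB fd mphi phi1 err s0.
have mphiS j : cmeasurable_fun S (phi j).
  by split; [exact: measurable_funS (mphi j).1|exact: measurable_funS (mphi j).2].
have sphi j : sqint mu S (phi j) by exact: sqint_bounded (phi1 j).
pose w i := approx_error ef phi (c i) (gam i).
have sw i : sqint mu S (w i).
  split; first exact: cmeasurable_approx_error.
  exact: le_lt_trans (err i) (ltry _).
pose D : 'M[R[i]]_n := \matrix_(i, j) ((i == j)%:R - L2inner mu S (f i) (ef (gam j))).
pose E : 'M[R[i]]_n := \matrix_(i, j) L2inner mu S (f i) (w j).
pose U : 'M[R[i]]_(n, #|J|) := \matrix_(i, k) L2inner mu S (f i) (phi (enum_val k)).
pose V : 'M[R[i]]_(#|J|, n) := \matrix_(k, j) conjc (c j (enum_val k)).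
have dec : 1%:M = D + E + U *m V.
  apply/matrixP => i j; rewrite !mxE (L2inner_approx mS (sf i) (sw j) sphi).
  have -> : \sum_k U i k * V k j =
      \sum_k conjc (c j k) * L2inner mu S (f i) (phi k).
    rewrite [RHS](reindex _ (onW_bij _ (@enum_val_bij J)))/=.
    by apply: eq_bigr => k _; rewrite !mxE mulrC.
  by rewrite -addrA subrK.
have H : (n - \rank (U *m V))%:R <=
    \sum_i \sum_j csq (D i j) + (s * (n%:R * B) + s^-1 * (n%:R * eps)).
  apply: corank_le dec _ => Q Qh QQ.
  rewrite (eq_bigr (fun i => \sum_j L2inner mu S (f i) (w j) * Q j i)).
    exact: projection_pairing_integral.
  by move=> i _; apply: eq_bigr => j _; rewrite mxE.
have HD : \sum_i \sum_j csq (D i j) <= n%:R * d2.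
  apply: (@le_trans _ _ (\sum_(i < n) d2)); last first.
    by rewrite sumr_const card_ord mulr_natl.
  apply: ler_sum => i _; apply: le_trans (fd i); apply: ler_sum => j _.
  by rewrite mxE -csqN opprB.
have rk : (\rank (U *m V) <= #|J|)%N by exact: mulmx_max_rank.
have rkR : (\rank (U *m V))%:R <= #|J|%:R :> R by rewrite ler_nat.
move: H; rewrite natrB ?rank_leq_row// => H.
nra.
Qed.

End Counting.

(** * Density of the frequencies *)

Section Density.
Variable R : realType.
Local Notation mu := (@completed_lebesgue_measure R).
Local Notation X := (lebesgueTypeR R).

Lemma le_sqr_of_sqrte_le (x : \bar R) (K : R) :
  (0 <= x)%E -> 0 <= K -> (sqrte x <= K%:E)%E -> (x <= (K ^+ 2)%:E)%E.
Proof.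
move=> x0 K0; have {1}-> : K%:E = sqrte (K ^+ 2)%:E.
  by rewrite /= sqrtr_sqr ger0_norm.
by rewrite lee_sqrt// lee_fin sqr_ge0.
Qed.

Lemma counting_le (A : set R) (b : R) :
  (forall n (gam : 'I_n -> R), injective gam -> (forall i, A (gam i)) -> n%:R <= b) ->
  ((counting A : \bar R) <= b%:E)%E.
Proof.
move=> H; have [fA|iA] := pselect (finite_set A); last first.
  have /infiniteP/pcard_leP[f] := iA.
  have bb : (Num.truncn b).+1%:R <= b.
    apply: (H _ (fun i => f i)) => [i j|i]; last exact: funS.
    by move=> /(inj (mem_set I) (mem_set I))/val_inj.
  by have := le_lt_trans bb (truncnS_gt b); rewrite ltxx.
rewrite /counting asboolT//; set s := finmap.enum_fset _; rewrite lee_fin.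
apply: (H _ (fun i : 'I_(size s) => nth 0 s i)).
  move=> i j /eqP; rewrite nth_uniq ?finmap.fset_uniq ?ltn_ord// => /eqP ij.
  exact: val_inj.
move=> i; have : nth 0 s i \in s by apply: mem_nth.
by rewrite in_fset_set// inE.
Qed.

Lemma finite_sum_ell2norm (L : set R) (a : R -> R[i]) (K : R) n (gam : 'I_n -> R) :
  0 <= K -> (ell2norm L a <= K%:E)%E -> injective gam -> (forall i, L (gam i)) ->
  \sum_i csq (a (gam i)) <= K ^+ 2.
Proof.
move=> K0 aK inj Lg; rewrite -lee_fin.
have := le_sqr_of_sqrte_le _ K0 aK; rewrite esum_ge0 => [/(_ isT)|t _]; last first.
  by rewrite lee_fin sqr_ge0.
apply: le_trans; apply: esum_ge; pose r := [seq gam i | i <- enum 'I_n].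
exists [set` r].
  split; first exact: finite_seq.
  by move=> _ /mapP[i _ ->].
rewrite /r -fsbig_seq; last by rewrite map_inj_uniq// enum_uniq.
rewrite big_map big_enum /= sumEFin lee_fin.
by apply: ler_sum => i _; rewrite csqE.
Qed.

Lemma upper_density_le (L : set R) (rho : R) : 0 <= rho ->
  (forall e : R, 0 < e -> exists C : R, forall x r : R, 0 <= r ->
    ((counting (L `&` `[x, (x + r)%R]) : \bar R) <= ((rho + e) * r + C)%:E)%E) ->
  (upper_density L <= rho%:E)%E.
Proof.
move=> rho0 H; rewrite /upper_density.
set F := (X in lim (X @ _)).
have [cF|ncF] := pselect (cvg (F r @[r --> +oo])); last first.
  (* a divergent [lim] is the default value [point], which is [0] in [\bar R] *)
  by rewrite (dvgP ncF) lee_fin.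
apply/lee_addgt0Pr => e e0; have e20 : 0 < e / 2 by rewrite divr_gt0.
have [C HC] := H (e / 2) e20.
apply: lime_le => //; near=> r.
have r0 : 0 < r by near: r; apply: nbhs_pinfty_gt; exact: num_real.
have rC : C / (e / 2) <= r by near: r; apply: nbhs_pinfty_ge; exact: num_real.
rewrite /F; apply: (@le_trans _ _ (r^-1%:E * ((rho + e / 2) * r + C)%:E)%E).
  apply: lee_wpmul2l; first by rewrite lee_fin invr_ge0 ltW.
  by apply: ge_ereal_sup => _ [x _ <-]; apply: HC; exact: ltW.
rewrite -EFinM -EFinD lee_fin ler_pdivrMl//.
by move: rC; rewrite ler_pdivrMr//; nra.
Unshelve. all: by end_near. Qed.

Lemma sqint_inL2 (S : set X) (f : X -> R[i]) : inL2 mu S f -> sqint mu S f.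
Proof.
move=> [mf foo]; split=> //.
have f0 : (0 <= \int[mu]_(t in S) ((Normc.normc (f t)) ^+ 2)%:E)%E.
  by apply: integral_ge0 => t _; rewrite lee_fin sqr_ge0.
under eq_integral do rewrite -csqE.
rewrite -ge0_fin_numE// -sqrte_fin_num// ge0_fin_numE//; exact: sqrte_ge0.
Qed.

(** [counting_bound] applied to an arbitrary finite part of the window, with
[exp_approx_finite_measure] supplying the approximants. It reads
[n * (kap - eta) <= (m + eta) * r + C], and [eta] is chosen so small that
[(m + eta) / (kap - eta) <= m / kap + e]. *)
Lemma window_count (d : R) (S L : set R) :
  0 < d -> d < 1 -> lebesgue_measurable S -> (mu S < +oo)%E ->
  approx_unif_minimal d S L ->
  forall e : R, 0 < e -> exists C : R, forall x r : R, 0 <= r ->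
    ((counting (L `&` `[x, (x + r)%R]) : \bar R) <=
     ((fine (mu S) / (1 - d ^+ 2) + e) * r + C)%:E)%E.
Proof.
move=> d0 d1 mS Soo [g [gL2 gsup gd]] e e0.
set m := fine (mu S).
have m0 : 0 <= m by rewrite fine_ge0.
pose kap := 1 - d ^+ 2.
have kap0 : 0 < kap by rewrite subr_gt0 expr_lt1// ltW.
have [B [B0 gB]] : exists B : R, 0 < B /\ forall l, L l ->
    (\int[mu]_(t in S) (csq (g l t))%:E <= B%:E)%E.
  set K := ereal_sup _ in gsup.
  exists (fine K ^+ 2 + 1); split; first by rewrite ltr_pwDr// sqr_ge0.
  move=> l Ll.
  have lK : (L2norm mu S (g l) <= K)%E by apply: ereal_sup_ubound; exists l.
  have K0 : (0 <= K)%E by apply: le_trans lK; exact: sqrte_ge0.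
  have Kf : K \is a fin_num by rewrite ge0_fin_numE.
  under eq_integral do rewrite -csqE.
  apply: (@le_trans _ _ (fine K ^+ 2)%:E); last by rewrite lee_fin lerDl.
  apply: le_sqr_of_sqrte_le; [|exact: fine_ge0|by rewrite fineK].
  by apply: integral_ge0 => t _; rewrite lee_fin sqr_ge0.
pose eta := Num.min (kap / 2) (e * kap ^+ 2 / (2 * (kap + m))).
have km0 : 0 < 2 * (kap + m) by rewrite mulr_gt0// ltr_wpDr.
have eta0 : 0 < eta.
  by rewrite lt_min !divr_gt0// mulr_gt0// exprn_gt0.
have eta1 : eta <= kap / 2 by rewrite ge_min lexx.
have eta2 : eta * (2 * (kap + m)) <= e * kap ^+ 2.
  by rewrite -ler_pdivlMr// ge_min lexx orbT.
have ke0 : 0 < kap - eta by lra.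
(* [s] and [eps] make the error term [s * B + s^-1 * eps] equal to [eta] *)
pose s := eta / (2 * B).
have s0 : 0 < s by rewrite divr_gt0// mulr_gt0.
pose eps := s * eta / 2.
have eps0 : 0 < eps by rewrite divr_gt0// mulr_gt0.
have sE : s * B + s^-1 * eps = eta.
  by rewrite /eps /s; field; rewrite !gt_eqF.
pose e' := Num.min eta eps.
have e'0 : 0 < e' by rewrite lt_min eta0.
have [C HC] : approximable mu (@expi R : R -> X -> R[i]) S (m + eta) eps.
  apply: approximable_le (exp_approx_finite_measure mS Soo e'0).
    by rewrite lerD2l ge_min lexx.
  by rewrite ge_min lexx orbT.
exists (C / (kap - eta)) => x r r0; apply: counting_le => n gam inj Lgam.
have [J [phi [cJ mphi phi1 err]]] := HC x r r0.
have errg i : exists c : J -> R[i],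
    (\int[mu]_(t in S) (csq (approx_error (@expi R) phi c (gam i) t))%:E <= eps%:E)%E.
  by apply: err; have [_] := Lgam i; rewrite /= in_itv.
have [c Hc] := choice errg.
have := @counting_bound _ X R mu S (@expi R) n gam (fun i => g (gam i)) B
  (d ^+ 2) eps s J phi c mS Soo (@cmeasurable_expi R).
rewrite sE => /(_ _ _ _ mphi phi1 Hc s0) H.
have {}H : n%:R * (1 - d ^+ 2 - eta) <= #|J|%:R.
  apply: H => i; have [Li _] := Lgam i.
  - exact/sqint_inL2/gL2.
  - exact: gB.
  have Lg j : L (gam j) by have [] := Lgam j.
  have := finite_sum_ell2norm (ltW d0) (gd _ Li) inj Lg.
  by under eq_bigr => j _ do rewrite (inj_eq inj) eq_sym.
have {H} : n%:R * (kap - eta) <= (m + eta) * r + C by apply: le_trans cJ.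
rewrite -ler_pdivlMr// => /le_trans; apply.
rewrite mulrDl lerD2r mulrAC ler_wpM2r//.
rewrite ler_pdivrMr// -/kap.
have -> : (m / kap + e) * (kap - eta) = m + e * kap - eta * (m / kap + e).
  by field; rewrite gt_eqF.
rewrite -addrA lerD2l lerBrDl -(ler_pM2r kap0).
have -> : (eta * (m / kap + e) + eta) * kap = eta * (m + kap) + eta * e * kap.
  by field; rewrite gt_eqF.
have ek : eta * (e * kap) <= kap / 2 * (e * kap).
  by rewrite ler_wpM2r// mulr_ge0// ltW.
by move: eta2 ek; rewrite expr2; lra.
Qed.

End Density.

Theorem theorem1p2 (R : realType) (d : R) (S Lambda : set R)
    (hd0 : 0 < d) (hd1 : d < 1)
    (mS : lebesgue_measurable S)
    (S_gt0 : (0 < completed_lebesgue_measure S)%E)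
    (S_fin : (completed_lebesgue_measure S < +oo)%E)
    (hLambda : uniformly_discrete Lambda)
    (hmin : approx_unif_minimal d S Lambda) :
  (upper_density Lambda <=
   completed_lebesgue_measure S / (1 - d ^+ 2)%:E)%E.
Proof.
have kap0 : 0 < 1 - d ^+ 2 by rewrite subr_gt0 expr_lt1// ltW.
have Sfin : completed_lebesgue_measure S \is a fin_num by rewrite ge0_fin_numE// ltW.
rewrite -(fineK Sfin) inver gt_eqF// -EFinM.
apply: upper_density_le; first by rewrite divr_ge0 ?fine_ge0// ltW.
exact: window_count.
Qed.
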